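(* Let $m, d$ be positive integers with $2^{d-1} \leq 2m < 2^d$. If $m \neq 2^{d-1}-2$, then $\beta_{2m}(d) = 2m+2$; if $m = 2^{d-1}-2$, then $\beta_{2m}(d) = 2m$.
   Context: $\beta_{2m}(d)$ denotes the largest size of a set $A \subseteq \mathbb{Z}_2^d$ (of distinct elements) which has no subset $B\subseteq A$ with $|B| = 2m$ and $\sum_{x\in B} x = 0$. *)

(* Defs.v *)
From mathcomp Require Import all_boot all_order all_algebra.
Set Implicit Arguments.
Unset Strict Implicit.
Unset Printing Implicit Defensive.
Import GRing.Theory.

Definition zero_sum_free (k d : nat) (A : {set 'rV['Z_2]_d}) : bool :=
  ~~ [exists B : {set 'rV['Z_2]_d},
        [&& B \subset A, #|B| == k & \sum_(x in B) x == 0]%R].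

(* For k > 0 the empty set is zero_sum_free, so this is a maximum over a
   nonempty family; for k = 0 no set qualifies and the value is 0 by default. *)
Definition beta (k d : nat) : nat :=
  \max_(A : {set 'rV['Z_2]_d} | zero_sum_free k A) #|A|.

(* Main.v *)
(* Let S be the sum of A.  If |A| = 2m + 2 and S = 0, a 2m-subset of A has the
   sum of its two missing elements, which are distinct, so its sum is nonzero.
   If |A| = 2m + 3, then |A| >= 2^(d-1) + 3 and pigeonhole gives three distinct
   elements of A with sum S; removing them leaves a zero-sum 2m-subset.  The
   same pigeonhole, applied to the complement of a small set, completes that
   set by three elements to one with sum 0; since the whole space sums to 0,
   the complement of the result is the required (2m + 2)-set.  When
   2m = 2^d - 4 the complement would be a pair, which never sums to 0, and
   any (2m + 1)-set contains its own sum because its complement is a triple. *)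
Require Import Defs.
From mathcomp Require Import all_boot all_order all_algebra.
From mathcomp Require Import zify.

Set Implicit Arguments.
Unset Strict Implicit.
Unset Printing Implicit Defensive.
Import GRing.Theory.

(* [lia] needs syntactically equal atoms, but elaborating [{set 'rV_d}] leaves
   [reverse_coercion] in some cardinals and not in others. *)
Ltac card_lia := unfold reverse_coercion in *; lia.

Lemma exists_subset_card (T : finType) (A : {set T}) k :
  k <= #|A| -> exists2 B : {set T}, B \subset A & #|B| = k.
Proof.
case/card_geqP=> s [uniq_s <- sub_s]; exists [set x in s].
  by apply/subsetP => x; rewrite inE => /sub_s.
by rewrite cardsE; apply/card_uniqP.
Qed.

Section BinarySpace.

Variable d : nat.
Local Notation V := 'rV['Z_2]_d.
Implicit Types (x y s t : V) (A B C : {set V}) (k : nat).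
Local Open Scope ring_scope.

Lemma addvv x : x + x = 0.
Proof. by apply/rowP => i; rewrite !mxE; case: (x 0 i) => -[|[]] // ?; apply/val_inj. Qed.

Lemma oppv x : - x = x.
Proof. by apply/eqP; rewrite eq_sym -addr_eq0 addvv. Qed.

Lemma addv_eq0 x y : (x + y == 0) = (x == y).
Proof. by rewrite addr_eq0 oppv. Qed.

Lemma card_space : #|{: V}| = (2 ^ d)%N.
Proof. by rewrite card_mx card_ord mul1n. Qed.

Lemma sum_setD A B : B \subset A ->
  \sum_(x in A :\: B) x = \sum_(x in A) x + \sum_(x in B) x.
Proof.
move=> sBA; rewrite [\sum_(x in A) x](big_setID B) /= (setIidPr sBA).
by rewrite addrAC addvv add0r.
Qed.

Lemma sum_space : (1 < d)%N -> \sum_(x : V) x = 0.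
Proof.
move=> d_gt1; apply/rowP => i; rewrite [RHS]mxE.
have [j neq_ji] : exists j : 'I_d, j != i.
  apply/existsP; rewrite -negb_forall; apply/negP => /forallP all_i.
  have /subset_leq_card : [set: 'I_d] \subset [set i].
    by apply/subsetP => j _; rewrite inE all_i.
  by rewrite cardsT card_ord cards1 leqNgt d_gt1.
(* The shear adding coordinate [i] to coordinate [j] permutes the space. *)
pose f x := x + x 0 i *: delta_mx 0 j.
have fK : involutive f.
  move=> x; rewrite /f !mxE [i == j]eq_sym (negPf neq_ji) mulr0 addr0.
  by rewrite -addrA addvv addr0.
(* Reindexing by the shear fixes the total, so the added multiple of [delta_mx 0 j] vanishes; its
   coefficient is coordinate [i] of the total. *)
have : \sum_(x : V) x = \sum_(x : V) x + (\sum_(x : V) x) 0 i *: delta_mx 0 j.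
  rewrite {1}(reindex_inj (inv_inj fK)) /= /f big_split /= summxE scaler_suml.
  by [].
move/eqP; rewrite -[X in X == _]addr0 => /eqP/addrI/rowP/(_ j).
by rewrite !mxE !eqxx mulr1.
Qed.

Lemma sum_setC A : (1 < d)%N -> \sum_(x in ~: A) x = \sum_(x in A) x.
Proof.
move=> d_gt1; rewrite -setTD sum_setD ?subsetT //.
by rewrite (eq_bigl predT) => [|x]; rewrite ?inE // sum_space // add0r.
Qed.

Lemma sum_pair_neq0 A : #|A| = 2%N -> \sum_(x in A) x != 0.
Proof.
move/eqP/cards2P=> [x [y [neq_xy ->]]].
by rewrite big_setU1 ?inE //= big_set1 addv_eq0.
Qed.

(** Fix [x] in [A] other than [s], so that [t = s + x] is nonzero. The bound says 2(|A| - 1) > 2^d,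
    so [A :\ x] meets its translate by [t]: some [y = z + t], whence x + y + z = s, and [y != z]
    because [t] is nonzero. *)
Lemma exists_triple_sum A s : (2 ^ d + 2 < 2 * #|A|)%N ->
  exists C, [/\ C \subset A, #|C| = 3%N & \sum_(x in C) x = s].
Proof.
move=> cardA.
have [|x /setD1P[neq_xs xA]] := @set0Pn _ (A :\ s) _.
  rewrite -card_gt0; have := cardsD1 s A.
  by case: (s \in A); card_lia.
pose t := s + x; pose A' := A :\ x; pose At := [set y + t | y in A'].
have cardAt : #|At| = #|A'| by rewrite card_imset //; apply: addIr.
have [|y /setIP[yA' /imsetP[z zA' def_y]]] := @set0Pn _ (A' :&: At) _.
  rewrite -card_gt0; have := cardsUI A' At; have := cardsD1 x A.
  have := subset_leq_card (subsetT (A' :|: At)).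
  rewrite cardsT card_space cardAt xA -/A'; lia.
have [/setD1P[neq_yx yA] /setD1P[neq_zx zA]] := (yA', zA').
have neq_yz : y != z.
  by rewrite def_y -subr_eq0 addrAC subrr add0r addv_eq0 eq_sym.
have x_notin : x \notin [set y; z].
  by rewrite !inE negb_or ![x == _]eq_sym neq_yx.
exists (x |: [set y; z]); split.
- by apply/subsetP => u /setU1P[->|/set2P[] ->].
- by rewrite cardsU1 x_notin cards2 neq_yz.
- rewrite big_setU1 //= big_setU1 ?inE //= big_set1 def_y [z + t]addrC -addrA addvv addr0.
  by rewrite /t addrC -addrA addvv addr0.
Qed.

Lemma exists_card_sum0 k : (2 < k)%N -> (2 * k + 2 <= 2 ^ d + 4)%N ->
  (2 < 2 ^ d)%N ->
  exists2 C : {set V}, #|C| = k & \sum_(x in C) x = 0.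
Proof.
move=> k_gt2 k_le d_gt1.
have [|D _ cardD] := @exists_subset_card _ [set: V] (k - 3).
  rewrite cardsT card_space; lia.
(* The upper bound on [k] gives 2(2^d - k + 3) > 2^d + 2, as the triple lemma requires of [~: D]. *)
have [|T [sTD cardT sumT]] := @exists_triple_sum (~: D) (\sum_(x in D) x).
  have := cardsC D; rewrite card_space; lia.
have disDT : [disjoint D & T] by rewrite disjoint_sym disjoints_subset.
exists (D :|: T); first by rewrite cardsU disjoint_setI0 // cards0; lia.
rewrite (eq_bigl [in [predU D & T]]) => [|x]; last by rewrite !inE.
by apply/eqP; rewrite bigU //= addv_eq0; apply/eqP/esym.
Qed.

Lemma zero_sum_freeS k A B :
  B \subset A -> zero_sum_free k A -> zero_sum_free k B.
Proof.
move=> sBA; apply: contra => /existsP[C /andP[sCB CP]].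
by apply/existsP; exists C; rewrite (subset_trans sCB sBA).
Qed.

Lemma beta_ge k A : zero_sum_free k A -> (#|A| <= beta k d)%N.
Proof. exact: leq_bigmax_cond. Qed.

(** Freeness passes to subsets, so excluding one cardinality excludes every larger one. *)
Lemma beta_le k n :
  (forall A, #|A| = n.+1 -> ~~ zero_sum_free k A) -> (beta k d <= n)%N.
Proof.
move=> nofree; apply/bigmax_leqP => A freeA; rewrite leqNgt; apply/negP.
case/exists_subset_card => B sBA cardB.
by have /negP[] := nofree B cardB; apply: zero_sum_freeS freeA.
Qed.

Lemma not_zero_sum_free_remove k A C :
  C \subset A -> #|A| = (k + #|C|)%N ->
  \sum_(x in C) x = \sum_(x in A) x -> ~~ zero_sum_free k A.
Proof.
move=> sCA cardA sumC; apply/negPn/existsP; exists (A :\: C).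
rewrite subsetDl cardsD (setIidPr sCA) cardA addnK eqxx /=.
by rewrite sum_setD // sumC addvv.
Qed.

Lemma beta_le_add2 k : (2 ^ d <= 2 * k)%N -> (beta k d <= k + 2)%N.
Proof.
move=> k_ge; apply: beta_le => A cardA.
have [|C [sCA cardC sumC]] := @exists_triple_sum A (\sum_(x in A) x); first lia.
apply: not_zero_sum_free_remove sCA _ sumC; lia.
Qed.

Lemma zero_sum_free_sum0 k A :
  #|A| = (k + 2)%N -> \sum_(x in A) x = 0 -> zero_sum_free k A.
Proof.
move=> cardA sumA; apply/existsP => -[B /and3P[sBA /eqP cardB /eqP sumB]].
have /sum_pair_neq0/eqP[] : #|A :\: B| = 2%N.
  rewrite cardsD (setIidPr sBA); lia.
by rewrite sum_setD // sumA sumB addr0.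
Qed.

Lemma zero_sum_free_card A :
  \sum_(x in A) x != 0 -> zero_sum_free #|A| A.
Proof.
move=> sumA; apply/existsP => -[B /and3P[sBA /eqP cardB sumB]].
have eqBA : B = A by apply/eqP; rewrite eqEcard sBA cardB /=.
by rewrite eqBA (negPf sumA) in sumB.
Qed.

Lemma beta_exceptional_le : (1 < d)%N -> (beta (2 ^ d - 4) d <= 2 ^ d - 4)%N.
Proof.
move=> d_gt1; apply: beta_le => A cardA.
have d_ge4 : (4 <= 2 ^ d)%N by exact: (@leq_pexp2l 2 2 d).
have cardCA : #|~: A| = 3%N by have := cardsC A; rewrite card_space; lia.
have sumA_in : \sum_(x in A) x \in A.
  (* The triple [~: A] has the same sum as [A]. If it contained that sum, its other two elements
     would add up to 0. *)
  rewrite -[_ \in A]negbK -in_setC; apply/negP => sCA.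
  have /sum_pair_neq0/eqP[] : #|~: A :\ \sum_(x in A) x| = 2%N.
    by apply: (@addnI 1); rewrite -[RHS]cardCA [RHS](cardsD1 (\sum_(x in A) x)) sCA.
  by rewrite sum_setD ?sub1set // big_set1 sum_setC // addvv.
apply: (@not_zero_sum_free_remove _ _ [set \sum_(x in A) x]).
- by rewrite sub1set.
- rewrite cards1; lia.
- by rewrite big_set1.
Qed.

(** A set with exactly 2^d - 4 elements is free once its sum is nonzero. Its complement has the same
    sum, so it suffices to extend a triple [D] by a fourth element different from the sum of [D]. *)
Lemma beta_exceptional_ge : (2 < d)%N -> (2 ^ d - 4 <= beta (2 ^ d - 4) d)%N.
Proof.
move=> d_gt2; have d_ge8 : (8 <= 2 ^ d)%N by exact: (@leq_pexp2l 2 3 d).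
have [|D _ cardD] := @exists_subset_card _ [set: V] 3.
  rewrite cardsT card_space; lia.
have exN s : exists x, x \in ~: (s |: D).
  apply/set0Pn; rewrite -card_gt0; have := cardsC (s |: D).
  by rewrite card_space cardsU1; case: (s \notin D); card_lia.
have [x] := exN (\sum_(x in D) x).
rewrite !inE negb_or => /andP[neq_x xD].
have cardC : #|~: (x |: D)| = (2 ^ d - 4)%N.
  by have := cardsC (x |: D); rewrite card_space cardsU1 xD; card_lia.
rewrite -{1}cardC; apply: beta_ge; rewrite -cardC; apply: zero_sum_free_card.
by rewrite sum_setC ?(ltnW d_gt2) // big_setU1 //= addv_eq0.
Qed.

End BinarySpace.

Theorem theorem4 (m d : nat) (m_gt0 : 0 < m) (d_gt0 : 0 < d)
    (lower : 2 ^ d.-1 <= 2 * m) (upper : 2 * m < 2 ^ d) :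
  (m <> 2 ^ d.-1 - 2 -> beta (2 * m) d = 2 * m + 2) /\
  (m = 2 ^ d.-1 - 2 -> beta (2 * m) d = 2 * m).
Proof.
have expd : 2 ^ d = 2 * 2 ^ d.-1 by rewrite -expnS prednK.
have d_gt1 : 1 < d.
  by move: lower upper; case: d d_gt0 {expd} => [|[|?]] //; rewrite /= expn0 expn1; lia.
split=> [m_neq | m_eq]; apply/eqP; rewrite eqn_leq; apply/andP; split.
- by apply: beta_le_add2; lia.
(* [C] is the complement of the extremal set. Its size is even and differs from 2 by [m_neq], so it
   is 0 or at least 4. *)
- have [C cardC sumC] : exists2 C : {set 'rV['Z_2]_d},
      #|C| = 2 ^ d - (2 * m + 2) & (\sum_(x in C) x = 0)%R.
    have [full | not_full] := leqP (2 ^ d) (2 * m + 2).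
      by exists set0; rewrite ?big_set0 // cards0; lia.
    by apply: exists_card_sum0; lia.
  have cardCC : #|~: C| = 2 * m + 2.
    by have := cardsC C; rewrite card_space; lia.
  rewrite -{1}cardCC; apply: beta_ge; apply: zero_sum_free_sum0 => //.
  by rewrite sum_setC.
- have -> : 2 * m = 2 ^ d - 4 by lia.
  exact: beta_exceptional_le.
(* For d = 2 the exceptional value of [m] would be 0. *)
- have d_gt2 : 2 < d.
    case: d d_gt1 m_eq {d_gt0 lower upper expd} => [|[|[|?]]] //=.
    by rewrite expn1; lia.
  have -> : 2 * m = 2 ^ d - 4 by lia.
  exact: beta_exceptional_ge.
Qed.
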